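(* Let $0<m\le L$, $\kappa=L/m$, $1\le c<2$, $\underline{\alpha}=\frac{1}{cL}$ and $\overline{\alpha}=\frac{c}{L}$. Consider the semidefinite program of minimizing $\gamma^2$ over positive definite matrices $P\in\mathbb{R}^{n\times n}$, scalars $\lambda\ge 0$ and scalars $\gamma>0$, subject to the constraints that $$\begin{bmatrix} I_n & -\alpha P\\ -\alpha P & \alpha^2P\end{bmatrix}+\lambda\begin{bmatrix} -2mL\,I_n & (L+m)I_n\\ (L+m)I_n & -2I_n\end{bmatrix}\preceq 0\qquad\text{and}\qquad \gamma^2\ge\alpha^2\,\mathrm{tr}(P)$$ both hold for $\alpha=\underline{\alpha}$ and for $\alpha=\overline{\alpha}$. Then the noise amplification metric $\gamma_{\mathrm{varying}}$ for varying step size gradient descent based on the solution of this program (the optimal value of $\gamma$) satisfies $$\gamma_{\mathrm{varying}}\ge\gamma^*_{\mathrm{varying}}=\begin{cases}\frac{c}{L}\sqrt{\frac{n}{2c-c^2}}, & \kappa\le\frac{c}{2-c},\\[4pt] \frac{c}{m}\sqrt{\frac{n}{2c\kappa-c^2}}, & \kappa>\frac{c}{2-c}.\end{cases}$$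
   Context: $I_n$ is the $n\times n$ identity matrix and $\preceq 0$ means negative semidefinite. The setting is noisy gradient descent $x_{k+1}=x_k-\alpha_k(\nabla f(x_k)+w_k)$ on $\mathbb{R}^n$ with step sizes $\alpha_k\in[\underline{\alpha},\overline{\alpha}]$ and $w_k$ white noise with zero mean and identity covariance, for $f:\mathbb{R}^n\to\mathbb{R}$ that is $m$-strongly convex with $L$-Lipschitz gradient and minimizer at the origin; $\kappa=L/m$ is the condition number. The constraints are the paper's conditions $$\begin{bmatrix} A^TPA-P+C_e^TC_e & A^TPB_u(\alpha)\\ B_u^T(\alpha)PA & B_u^T(\alpha)PB_u(\alpha)\end{bmatrix}+\lambda\begin{bmatrix} C_y&0\\0&I_n\end{bmatrix}^TM\begin{bmatrix} C_y&0\\0&I_n\end{bmatrix}\preceq 0,\qquad \gamma^2\ge\mathrm{tr}\big(B_w^T(\alpha)PB_w(\alpha)\big),$$ with $A=C_y=C_e=I_n$, $B_u(\alpha)=-\alpha I_n$, $B_w(\alpha)=\alpha I_n$ and $M=\begin{bmatrix}-2mL&L+m\\L+m&-2\end{bmatrix}\otimes I_n$, the matrix of the sector constraint satisfied by $\nabla f$. Here $\gamma_{\mathrm{varying}}$ denotes the infimum of $\gamma$ over all feasible $(P,\lambda,\gamma)$ (with the infimum of the empty set equal to $+\infty$). *)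

(* Defs.v *)
From HB Require Import structures.
From mathcomp Require Import all_boot all_order all_algebra.
From mathcomp Require Import all_classical all_reals ereal.
Set Implicit Arguments.
Unset Strict Implicit.
Unset Printing Implicit Defensive.
Import Order.TTheory GRing.Theory Num.Theory.
Local Open Scope ring_scope.

Definition posdefmx (R : realType) (n : nat) (P : 'M[R]_n) : Prop :=
  P^T = P /\ forall x : 'cV[R]_n, x != 0 -> 0 < (x^T *m P *m x) 0 0.

Definition negsemidefmx (R : realType) (n : nat) (S : 'M[R]_n) : Prop :=
  S^T = S /\ forall x : 'cV[R]_n, (x^T *m S *m x) 0 0 <= 0.

(* The performance block is the dissipation matrix of the loop with
   A = C_y = C_e = I_n and B_u(alpha) = - alpha I_n, so its upper left block
   A^T P A - P + C_e^T C_e is I_n. *)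
Definition performance_mx (R : realType) (n : nat) (P : 'M[R]_n) (alpha : R) :
    'M[R]_(n + n) :=
  block_mx 1%:M (- (alpha *: P))
           (- (alpha *: P)) (alpha ^+ 2 *: P).

Definition sector_mx (R : realType) (n : nat) (m L : R) : 'M[R]_(n + n) :=
  block_mx (- (2 * m * L))%:M (L + m)%:M
           (L + m)%:M         (- 2)%:M.

Definition sdp_constraints (R : realType) (n : nat) (m L alpha : R)
    (P : 'M[R]_n) (lambda gamma : R) : Prop :=
  negsemidefmx (performance_mx P alpha + lambda *: sector_mx n m L) /\
  alpha ^+ 2 * \tr P <= gamma ^+ 2.

Definition sdp_feasible (R : realType) (n : nat) (m L alpha_lo alpha_hi : R)
    (P : 'M[R]_n) (lambda gamma : R) : Prop :=
  [/\ posdefmx P, 0 <= lambda, 0 < gamma,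
      sdp_constraints m L alpha_lo P lambda gamma &
      sdp_constraints m L alpha_hi P lambda gamma].

(* Extended-real valued, so that an infeasible program has value +oo. *)
Definition gamma_varying (R : realType) (n : nat) (m L alpha_lo alpha_hi : R) :
    \bar R :=
  ereal_inf [set (gamma%:E)%E | gamma in
    [set gamma : R | exists (P : 'M[R]_n) (lambda : R),
       sdp_feasible m L alpha_lo alpha_hi P lambda gamma]]%classic.

Definition gamma_star_varying (R : realType) (n : nat) (m L c : R) : R :=
  let kappa := L / m in
  if kappa <= c / (2 - c)
  then c / L * Num.sqrt (n%:R / (2 * c - c ^+ 2))
  else c / m * Num.sqrt (n%:R / (2 * c * kappa - c ^+ 2)).

(* Main.v *)
Require Import Defs.
From HB Require Import structures.
From mathcomp Require Import all_boot all_order all_algebra.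
From mathcomp Require Import all_classical all_reals ereal.
From mathcomp Require Import ring lra.
Import Order.TTheory GRing.Theory Num.Theory.
Local Open Scope ring_scope.

(** The matrix inequality certifies a noise bound for every gradient in the
    sector [[m, L]], in particular for the linear gradients [x |-> q x] with
    [m <= q <= L].  Testing the inequality on the pairs [(u, q u)] therefore
    gives a necessary condition on [P]: the sector term contributes
    [2 lambda (q - m) (L - q) |u|^2 >= 0] and can be dropped, which leaves the
    Lyapunov inequality of the scalar contraction [1 - alpha q],
    [|u|^2 <= (1 - (1 - alpha q)^2) u^T P u]
    ([performance_along_linear_gradient]).  Summing over the standard basis
    bounds [tr P] from below ([trace_bound]), and the noise constraint turns
    this into a lower bound on [gamma] ([gamma_bound]).  At the step
    [alpha = c / L] the slopes [q = L] and [q = m] give the two branches of the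
    stated bound, which is the larger of the two: with [kappa = L / m] they agree when
    [(kappa - 1) ((2 - c) kappa - c) = 0], and [q = L] gives the larger one
    for [1 <= kappa <= c / (2 - c)]. *)

Lemma block_quadratic_form (R : comPzRingType) (n : nat) (A B C D : 'M[R]_n)
    (q : R) (u : 'cV[R]_n) :
  (col_mx u (q *: u))^T *m block_mx A B C D *m col_mx u (q *: u) =
  u^T *m (A + q *: (B + C) + q ^+ 2 *: D) *m u.
Proof.
rewrite tr_col_mx mul_row_block mul_row_col linearZ /=.
rewrite !(mulmxDr, mulmxDl, =^~ scalemxAl, =^~ scalemxAr, scalerDr).
by rewrite scalerA -expr2 -!addrA; congr (_ + _); rewrite addrCA.
Qed.

(** This is where [P] is tied to the slope [q]: the multiplier [lambda] drops
    out because the graph of [u |-> q u] satisfies the sector constraint. *)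
Lemma performance_along_linear_gradient (R : realType) (n : nat)
    (m L alpha lambda q : R) (P : 'M[R]_n) (u : 'cV[R]_n) :
  0 <= lambda -> m <= q <= L ->
  negsemidefmx (performance_mx P alpha + lambda *: sector_mx n m L) ->
  (u^T *m u) 0 0 <= (2 * (alpha * q) - (alpha * q) ^+ 2) * (u^T *m P *m u) 0 0.
Proof.
move=> lambda_ge0 /andP[mq qL] [_ /(_ (col_mx u (q *: u)))].
rewrite /performance_mx /sector_mx scale_block_mx add_block_mx.
rewrite block_quadratic_form.
(* The multiple of the identity in S collects the output block and the sector
   term; the latter is nonnegative because q lies between m and L. *)
set S := (X in (u^T *m X *m u) 0 0 <= 0).
have -> : S = (1 + 2 * lambda * ((q - m) * (L - q)))%:M
              - (2 * (alpha * q) - (alpha * q) ^+ 2) *: P.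
  by apply/matrixP => i j; rewrite /S !mxE; case: (i == j);
    rewrite !(mulr1n, mulr0n); ring.
rewrite mulmxBr mulmxBl mul_mx_scalar -!scalemxAl -scalemxAr -scalemxAl.
rewrite !mxE subr_le0; apply: le_trans.
have uu_ge0 : 0 <= \sum_j u^T 0 j * u j 0.
  by apply: sumr_ge0 => j _; rewrite mxE -expr2 sqr_ge0.
rewrite ler_peMl // lerDl !mulr_ge0 // subr_ge0 //.
Qed.

Lemma trace_bound (R : realType) (n : nat) (m L alpha lambda q : R)
    (P : 'M[R]_n) :
  0 <= lambda -> m <= q <= L ->
  negsemidefmx (performance_mx P alpha + lambda *: sector_mx n m L) ->
  n%:R <= (2 * (alpha * q) - (alpha * q) ^+ 2) * \tr P.
Proof.
move=> lambda_ge0 mqL S_le0; rewrite /mxtrace mulr_sumr.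
rewrite -[X in X%:R]card_ord -sumr_const; apply: ler_sum => i _.
have := performance_along_linear_gradient _ _ _ _ _ _ _ _ (delta_mx i 0)
  lambda_ge0 mqL S_le0.
by rewrite trmx_delta mul_delta_mx -rowE -colE !mxE !eqxx.
Qed.

(** At the step [c / L] the factor in [trace_bound] is
    [2 c (q / L) - (c q / L)^2].  Multiplying it by [(L / q)^2] gives
    [2 c (L / q) - c^2], while the same scaling turns the squared step
    [(c / L)^2] of the noise constraint into [(c / q)^2]. *)
Lemma gamma_bound (R : realType) (n : nat) (m L c lambda gamma q : R)
    (P : 'M[R]_n) :
  0 < m -> 0 < c < 2 -> 0 <= lambda -> 0 < gamma -> m <= q <= L ->
  sdp_constraints m L (c / L) P lambda gamma ->
  c / q * Num.sqrt (n%:R / (2 * c * (L / q) - c ^+ 2)) <= gamma.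
Proof.
move=> m_gt0 /andP[c_gt0 c_lt2] lambda_ge0 gamma_gt0 mqL [S_le0 trP_le].
have n_le := trace_bound _ _ _ _ _ _ _ _ lambda_ge0 mqL S_le0.
have /andP[mq qL] := mqL.
have q_gt0 : 0 < q by exact: lt_le_trans mq.
have L_gt0 : 0 < L by exact: lt_le_trans qL.
have Lq_ge1 : 1 <= L / q by rewrite ler_pdivlMr ?mul1r.
have d_gt0 : 0 < 2 * c * (L / q) - c ^+ 2 by nra.
rewrite -ler_sqr ?nnegrE ?(ltW gamma_gt0) //; last first.
  by rewrite mulr_ge0 ?sqrtr_ge0 ?divr_ge0 ?ltW.
rewrite exprMn sqr_sqrtr; last by rewrite divr_ge0 ?ler0n // ltW.
rewrite [leLHS]mulrA ler_pdivrMr // [leRHS]mulrC.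
apply: (@le_trans _ _ ((2 * c * (L / q) - c ^+ 2) * ((c / L) ^+ 2 * \tr P))).
  have -> : (2 * c * (L / q) - c ^+ 2) * ((c / L) ^+ 2 * \tr P) =
      (c / q) ^+ 2 * ((2 * (c / L * q) - (c / L * q) ^+ 2) * \tr P).
    by field; rewrite !gt_eqF.
  by rewrite ler_wpM2l ?sqr_ge0.
by rewrite ler_pM2l.
Qed.

Theorem proposition2 (R : realType) (n : nat) (m L c : R)
    (hm : 0 < m) (hmL : m <= L) (hc1 : 1 <= c) (hc2 : c < 2) :
  ((gamma_star_varying n m L c)%:E
     <= gamma_varying n m L (1 / (c * L)) (c / L))%E.
Proof.
apply: le_ereal_inf_tmp
  => _ [gamma [P [lambda [_ lambda_ge0 gamma_gt0 _ constr_hi]]] <-].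
rewrite lee_fin.
have c_range : 0 < c < 2 by rewrite hc2 (lt_le_trans ltr01).
rewrite /gamma_star_varying; case: ifP => _.
  have L_neq0 : L != 0 by rewrite gt_eqF // (lt_le_trans hm).
  have LL : m <= L <= L by rewrite hmL /=.
  have := gamma_bound _ _ _ _ _ _ _ _ _
    hm c_range lambda_ge0 gamma_gt0 LL constr_hi.
  by rewrite divff // mulr1.
have mm : m <= m <= L by rewrite lexx.
exact: gamma_bound _ _ _ _ _ _ _ _ _
  hm c_range lambda_ge0 gamma_gt0 mm constr_hi.
Qed.
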